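(* Let $\mathbb{K}$ be a field and let $(L,\alpha_L)$ be an $\alpha$-perfect (multiplicative) Hom-Lie algebra over $\mathbb{K}$. Let $(\mathfrak{uce}_{\alpha}^{\rm Lie}(L),\widetilde{\alpha})$ and $(\mathfrak{uce}_{\alpha}^{\rm Leib}(L),\overline{\alpha})$ be its universal $\alpha$-central extensions in the categories of Hom-Lie algebras and of Hom-Leibniz algebras, respectively. Then $(\mathfrak{uce}_{\alpha}^{\rm Leib}(L),\overline{\alpha})$ is the universal central extension of the $\alpha$-perfect Hom-Lie algebra $(\mathfrak{uce}_{\alpha}^{\rm Lie}(L),\widetilde{\alpha})$ in the category of Hom-Leibniz algebras; that is, there is a surjective homomorphism $\Phi:(\mathfrak{uce}_{\alpha}^{\rm Leib}(L),\overline{\alpha})\to(\mathfrak{uce}_{\alpha}^{\rm Lie}(L),\widetilde{\alpha})$ which is a universal central extension in the category of Hom-Leibniz algebras. Moreover, there is an isomorphism of Hom-Lie algebras $$(\mathfrak{uce}_{\alpha}^{\rm Lie}(L),\widetilde{\alpha})\cong\big((\mathfrak{uce}_{\alpha}^{\rm Leib}(L))_{\rm Lie},\overline{\alpha}_{\rm Lie}\big).$$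
   Context: A (multiplicative) Hom-Leibniz algebra $(L,[-,-],\alpha_L)$, abbreviated $(L,\alpha_L)$, is a $\mathbb{K}$-vector space $L$ with a bilinear map $[-,-]:L\times L\to L$ and a linear map $\alpha_L:L\to L$ such that $[\alpha_L(x),[y,z]]=[[x,y],\alpha_L(z)]-[[x,z],\alpha_L(y)]$ and $\alpha_L[x,y]=[\alpha_L(x),\alpha_L(y)]$ for all $x,y,z\in L$. It is a Hom-Lie algebra if moreover $[x,x]=0$ for all $x\in L$. A homomorphism $f:(L,\alpha_L)\to(L',\alpha_{L'})$ is a linear map preserving brackets with $f\circ\alpha_L=\alpha_{L'}\circ f$. $(L,\alpha_L)$ is $\alpha$-perfect if $L=[\alpha_L(L),\alpha_L(L)]$ (span of all brackets $[\alpha_L(x),\alpha_L(y)]$); then $\alpha_L$ is surjective. The center is $Z(L)=\{x\in L : [x,y]=0=[y,x] \text{ for all } y\in L\}$. A surjective homomorphism $\pi:(K,\alpha_K)\to(L,\alpha_L)$ is a central extension if $\ker\pi\subseteq Z(K)$, and an $\alpha$-central extension if $\alpha_K(\ker\pi)\subseteq Z(K)$. A central extension $\pi:(K,\alpha_K)\to(L,\alpha_L)$ is universal (respectively, universal $\alpha$-central) in a category (Hom-Lie or Hom-Leibniz algebras) if for every central (respectively, $\alpha$-central) extension $\pi':(K',\alpha_{K'})\to(L,\alpha_L)$ in that category there is a unique homomorphism $h:(K,\alpha_K)\to(K',\alpha_{K'})$ with $\pi'\circ h=\pi$. Construction of the universal $\alpha$-central extensions of an $\alpha$-perfect Hom-Lie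 algebra $(L,\alpha_L)$: (Hom-Lie) $\mathfrak{uce}^{\rm Lie}_{\alpha}(L)=(\alpha_L(L)\wedge\alpha_L(L))/I$, where $I$ is spanned by the elements $-[x_1,x_2]\wedge\alpha_L(x_3)+[x_1,x_3]\wedge\alpha_L(x_2)-[x_2,x_3]\wedge\alpha_L(x_1)$, $x_i\in L$. Writing $\{\alpha_L(x_1),\alpha_L(x_2)\}$ for the class of $\alpha_L(x_1)\wedge\alpha_L(x_2)$, the bracket is $[\{\alpha_L(x_1),\alpha_L(x_2)\},\{\alpha_L(y_1),\alpha_L(y_2)\}]=\{[\alpha_L(x_1),\alpha_L(x_2)],[\alpha_L(y_1),\alpha_L(y_2)]\}$, the endomorphism is $\widetilde{\alpha}\{\alpha_L(x_1),\alpha_L(x_2)\}=\{\alpha_L^2(x_1),\alpha_L^2(x_2)\}$, and the projection to $L$ is $u_\alpha\{\alpha_L(x_1),\alpha_L(x_2)\}=[\alpha_L(x_1),\alpha_L(x_2)]$. (Hom-Leibniz) $\mathfrak{uce}^{\rm Leib}_{\alpha}(L)=(\alpha_L(L)\otimes\alpha_L(L))/I'$, where $I'$ is spanned by the elements $-[x_1,x_2]\otimes\alpha_L(x_3)+[x_1,x_3]\otimes\alpha_L(x_2)+\alpha_L(x_1)\otimes[x_2,x_3]$, $x_i\in L$; the bracket, the endomorphism $\overline{\alpha}$ and the projection $U_\alpha$ to $L$ are given by the same formulas, with $\{\alpha_L(x_1),\alpha_L(x_2)\}$ now denoting the class of $\alpha_L(x_1)\otimes\alpha_L(x_2)$. For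 a Hom-Leibniz algebra $(Q,\alpha_Q)$, $Q_{\rm Lie}=Q/Q^{\rm ann}$ where $Q^{\rm ann}=\langle\{[x,x]:x\in Q\}\rangle$ (the span of these elements, which is a two-sided ideal invariant under $\alpha_Q$ when $\alpha_Q$ is surjective, as is the case here), with the induced bracket and the induced endomorphism $(\alpha_Q)_{\rm Lie}$; it is a Hom-Lie algebra.
   Formalization: That the two explicit constructions really are universal α-central extensions of L (in Hom-Lie and in Hom-Leibniz algebras) is assumed: it is automatic if α_L is injective, but can fail for α-perfect L with non-injective α_L, and the proposition can then fail too. *)

(* Defs.v *)
From HB Require Import structures.
From mathcomp Require Import all_boot all_order all_algebra.
From mathcomp Require Import boolp.
From mathcomp Require Import freeg.

Set Implicit Arguments.
Unset Strict Implicit.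
Unset Printing Implicit Defensive.

Import GRing.Theory.
Local Open Scope ring_scope.
Local Open Scope quotient_scope.

Section Span.
Variables (K : fieldType) (V : lmodType K) (G : V -> Prop).

Definition is_lincomb (v : V) : Prop :=
  exists2 s : seq (K * V),
    (forall p, p \in s -> G p.2) & v = \sum_(p <- s) p.1 *: p.2.

Definition lspan : V -> bool := fun v => `[< is_lincomb v >].

Lemma lspan_submod : submod_closed lspan.
Proof.
split; first by apply/asboolP; exists [::] => //; rewrite big_nil.
move=> a u v /asboolP[s sG ->] /asboolP[t tG ->]; apply/asboolP.
exists ([seq (a * p.1, p.2) | p <- s] ++ t).
  move=> p; rewrite mem_cat => /orP[/mapP[q qs ->]|];
    [exact: (sG _ qs)|exact: tG].
rewrite big_cat big_map /= scaler_sumr; congr (_ + _).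
by apply: eq_bigr => p _; rewrite scalerA.
Qed.

HB.instance Definition _ := GRing.isSubmodClosed.Build K V lspan lspan_submod.

Lemma mem_lspan v : G v -> v \in lspan.
Proof.
move=> Gv; apply/asboolP; exists [:: (1, v)].
  by move=> p; rewrite inE => /eqP->.
by rewrite big_seq1 scale1r.
Qed.

Lemma lspan_ind (P : V -> Prop) :
  P 0 -> (forall a u v, P u -> P v -> P (a *: u + v)) ->
  (forall v, G v -> P v) -> forall v, v \in lspan -> P v.
Proof.
move=> P0 PD PG v /asboolP[s + ->]; elim: s => [|p s IH] sG.
  by rewrite big_nil.
rewrite big_cons; apply: PD.
  by apply: PG; apply: sG; rewrite mem_head.
by apply: IH => q qs; apply: sG; rewrite in_cons qs orbT.
Qed.

End Span.

Section QuotMod.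
Variables (K : fieldType) (V : lmodType K) (G : V -> Prop).

(* The quotient of V by the span of G. *)

Definition lspan_zmod : zmodClosed V := Algebra.ZmodClosed.clone V (lspan G) _.
Definition quotmod : Type := Quotient.quot lspan_zmod.

HB.instance Definition _ := GRing.Zmodule.on quotmod.

Definition cls (v : V) : quotmod := \pi_(Quotient.quot lspan_zmod) v.

Lemma cls_eqP v w : cls v = cls w <-> v - w \in lspan G.
Proof. by rewrite Quotient.idealrBE; split => [/eqP|/eqP]. Qed.

Lemma clsD : {morph cls : v w / v + w}.
Proof. by move=> v w; rewrite /cls raddfD. Qed.

Lemma cls_eq0 v : cls v = 0 <-> v \in lspan G.
Proof. by rewrite -[X in X \in _]subr0 -cls_eqP /cls raddf0. Qed.

Definition rep (q : quotmod) : V := repr (q : Quotient.quot lspan_zmod).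

Lemma repK : cancel rep cls. Proof. by move=> q; rewrite /cls reprK. Qed.

Definition quot_scale (a : K) (q : quotmod) : quotmod := cls (a *: rep q).

Lemma quot_scaleE a v : quot_scale a (cls v) = cls (a *: v).
Proof.
by apply/cls_eqP; rewrite -scalerBr rpredZ //; apply/cls_eqP; rewrite repK.
Qed.

Lemma cls_ind (P : quotmod -> Prop) : (forall v, P (cls v)) -> forall q, P q.
Proof. by move=> H q; rewrite -(repK q). Qed.

Fact quot_scaleA a b q : quot_scale a (quot_scale b q) = quot_scale (a * b) q.
Proof. by elim/cls_ind: q => v; rewrite !quot_scaleE scalerA. Qed.

Fact quot_scale1 : left_id 1 quot_scale.
Proof. by elim/cls_ind => v; rewrite quot_scaleE scale1r. Qed.

Fact quot_scaleDr : right_distributive quot_scale +%R.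
Proof.
move=> a; elim/cls_ind => v; elim/cls_ind => w.
by rewrite -clsD !quot_scaleE scalerDr clsD.
Qed.

Fact quot_scaleDl q : {morph quot_scale^~ q : a b / a + b}.
Proof.
by move=> a b /=; elim/cls_ind: q => v; rewrite !quot_scaleE scalerDl clsD.
Qed.

HB.instance Definition _ := GRing.Zmodule_isLmodule.Build K quotmod
  quot_scaleA quot_scale1 quot_scaleDr quot_scaleDl.

Fact cls_linear : linear cls.
Proof. by move=> a v w; rewrite clsD -quot_scaleE. Qed.

HB.instance Definition _ := GRing.isLinear.Build K V quotmod _ cls cls_linear.

(* The map induced on the quotient by a linear f that vanishes on G. *)
Definition quot_lift (W : lmodType K) (f : V -> W) (q : quotmod) : W :=
  f (rep q).

Section Lift.
Variables (W : lmodType K) (f : V -> W).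
Hypotheses (f_lin : linear f) (f0 : forall v, G v -> f v = 0).

Lemma quot_liftE v : quot_lift f (cls v) = f v.
Proof.
have f00 : f 0 = 0.
  by have := f_lin (-1) 0 0; rewrite scaler0 addr0 scaleN1r addNr.
have : rep (cls v) - v \in lspan G by apply/cls_eqP; rewrite repK.
have := f_lin 1 (rep (cls v) - v) v; rewrite !scale1r subrK /quot_lift => ->.
move: (rep _ - v); suff h w : w \in lspan G -> f w = 0.
  by move=> w /h ->; rewrite add0r.
move: w; apply: lspan_ind => [//|a u w fu fw|//].
by rewrite f_lin fu fw scaler0 addr0.
Qed.

Lemma quot_lift_linear : linear (quot_lift f).
Proof.
move=> a; elim/cls_ind => v; elim/cls_ind => w.
by rewrite -linearP !quot_liftE f_lin.
Qed.

End Lift.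

End QuotMod.
Arguments cls {K V} G v.
Arguments rep {K V G} q.
Arguments quot_lift {K V G W} f q.

Section Image.
Variables (K : fieldType) (V W : lmodType K) (f : {linear V -> W}).

Definition in_limage : W -> bool := fun w => `[< exists v, f v = w >].

Lemma in_limage_submod : submod_closed in_limage.
Proof.
split; first by apply/asboolP; exists 0; rewrite linear0.
move=> a u v /asboolP[x <-] /asboolP[y <-]; apply/asboolP.
by exists (a *: x + y); rewrite linearP.
Qed.

HB.instance Definition _ :=
  GRing.isSubmodClosed.Build K W in_limage in_limage_submod.

Definition limage : Type := {w : W | in_limage w}.

HB.instance Definition _ := SubChoice.on limage.
HB.instance Definition _ := [SubChoice_isSubLmodule of limage by <:].

End Image.

Section FreegLift.
Variables (R : nzRingType) (T : choiceType).

Lemma freeg_scale (a c : R) (z : T) :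
  a *: Freeg [:: (c, z)] = Freeg [:: (a * c, z)].
Proof. by apply/eqP/freeg_eqP => y; rewrite coeffZ !coeffU mulrA. Qed.

Lemma fglift_linear (M : lmodType R) (f : T -> M) : linear (fglift f).
Proof.
have addf := lift_is_additive f.
have f0 : fglift f 0 = 0 by have := addf 0 0; rewrite !subrr.
have fD : {morph fglift f : x y / x + y}.
  by move=> x y; rewrite -[y in LHS]opprK -[- y]sub0r !addf f0 sub0r opprK.
suff fZ a x : fglift f (a *: x) = a *: fglift f x.
  by move=> a x y; rewrite fD fZ.
rewrite -[x]freeg_sumE scaler_sumr !(big_morph _ fD f0) scaler_sumr.
by apply: eq_bigr => z _; rewrite freeg_scale !liftU scalerA.
Qed.

End FreegLift.

Section Tensor.
Variables (K : fieldType) (U W : lmodType K).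

(* The K-vector space with basis U * W. *)
Local Notation freemod := {freeg (U * W) / K}.

Definition gen (u : U) (w : W) : freemod := Freeg [:: (1, (u, w))].

Variant bilin_rel : freemod -> Prop :=
| BilinL a u u' w :
    bilin_rel (gen (a *: u + u') w - (a *: gen u w + gen u' w))
| BilinR a u w w' :
    bilin_rel (gen u (a *: w + w') - (a *: gen u w + gen u w')).

Definition tensor : Type := quotmod bilin_rel.
HB.instance Definition _ := GRing.Lmodule.on tensor.

Definition tens (u : U) (w : W) : tensor := cls bilin_rel (gen u w).

Lemma tensDl a u u' w : tens (a *: u + u') w = a *: tens u w + tens u' w.
Proof.
rewrite /tens -linearP; apply/cls_eqP; rewrite /= mem_lspan //; exact: BilinL.
Qed.

Lemma tensDr a u w w' : tens u (a *: w + w') = a *: tens u w + tens u w'.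
Proof.
rewrite /tens -linearP; apply/cls_eqP; rewrite /= mem_lspan //; exact: BilinR.
Qed.

Lemma freemod_ind (P : freemod -> Prop) :
  P 0 -> (forall a x y, P x -> P y -> P (a *: x + y)) ->
  (forall u w, P (gen u w)) -> forall x, P x.
Proof.
move=> P0 PD Pg x; rewrite -[x]freeg_sumE; elim: (dom x) => [|[u w] s IH].
  by rewrite big_nil.
rewrite big_cons.
suff -> : Freeg [:: (coeff (u, w) x, (u, w))] = coeff (u, w) x *: gen u w.
  exact: PD.
by rewrite /gen freeg_scale mulr1.
Qed.

Lemma tensor_ind (P : tensor -> Prop) :
  P 0 -> (forall a x y, P x -> P y -> P (a *: x + y)) ->
  (forall u w, P (tens u w)) -> forall x, P x.
Proof.
move=> P0 PD Pt; elim/cls_ind; apply: freemod_ind => [|a x y|//].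
  by rewrite linear0.
by rewrite linearP; exact: PD.
Qed.

Section Lift.
Variables (M : lmodType K) (f : U -> W -> M).
Hypothesis f_linl : forall w, linear (f^~ w).
Hypothesis f_linr : forall u, linear (f u).

Definition free_lift : freemod -> M := fglift (fun p => f p.1 p.2).

Lemma free_liftE u w : free_lift (gen u w) = f u w.
Proof. by rewrite /free_lift liftU scale1r. Qed.

Fact free_lift_linear : linear free_lift.
Proof.
exact: fglift_linear.
Qed.

Definition tensor_lift : tensor -> M := quot_lift free_lift.

Fact free_lift_rel x : bilin_rel x -> free_lift x = 0.
Proof.
have subE (y z : freemod) : free_lift (y - z) = free_lift y - free_lift z.
  by have := free_lift_linear (-1) z y; rewrite !scaleN1r ![- _ + _]addrC.
by case=> *; rewrite subE free_lift_linear !free_liftE ?f_linl ?f_linr subrr.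
Qed.

Lemma tensor_liftE u w : tensor_lift (tens u w) = f u w.
Proof.
rewrite /tensor_lift quot_liftE; first exact: free_liftE.
  exact: free_lift_linear.
exact: free_lift_rel.
Qed.

Lemma tensor_lift_linear : linear tensor_lift.
Proof.
by apply: quot_lift_linear; [exact: free_lift_linear|exact: free_lift_rel].
Qed.

End Lift.
End Tensor.

Section Wedge.
Variables (K : fieldType) (U : lmodType K).

Variant alt_rel : tensor U U -> Prop := Alt u : alt_rel (tens u u).

Definition exterior2 : Type := quotmod alt_rel.
HB.instance Definition _ := GRing.Lmodule.on exterior2.

Definition wedge (u v : U) : exterior2 := cls alt_rel (tens u v).

Lemma wedgeDl a u u' v : wedge (a *: u + u') v = a *: wedge u v + wedge u' v.
Proof. by rewrite /wedge tensDl linearP. Qed.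

Lemma wedgeDr a u v v' : wedge u (a *: v + v') = a *: wedge u v + wedge u v'.
Proof. by rewrite /wedge tensDr linearP. Qed.

Lemma wedgexx u : wedge u u = 0.
Proof. by apply/cls_eq0; apply: mem_lspan. Qed.

Lemma wedgeC u v : wedge u v = - wedge v u.
Proof.
apply/eqP; rewrite -addr_eq0; apply/eqP; have := wedgexx (1 *: u + v).
by rewrite wedgeDl !wedgeDr !wedgexx !scale1r add0r addr0.
Qed.

Lemma exterior2_ind (P : exterior2 -> Prop) :
  P 0 -> (forall a x y, P x -> P y -> P (a *: x + y)) ->
  (forall u v, P (wedge u v)) -> forall x, P x.
Proof.
move=> P0 PD Pw; elim/cls_ind; apply: tensor_ind => [|a x y|//].
  by rewrite linear0.
by rewrite linearP; exact: PD.
Qed.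

Section Lift.
Variables (M : lmodType K) (f : U -> U -> M).
Hypothesis f_linl : forall w, linear (f^~ w).
Hypothesis f_linr : forall u, linear (f u).
Hypothesis f_alt : forall u, f u u = 0.

Definition wedge_lift : exterior2 -> M := quot_lift (tensor_lift f).

Fact tensor_lift_alt x : alt_rel x -> tensor_lift f x = 0.
Proof. by case=> u; rewrite tensor_liftE. Qed.

Lemma wedge_liftE u v : wedge_lift (wedge u v) = f u v.
Proof.
rewrite /wedge_lift quot_liftE; first exact: tensor_liftE.
  exact: tensor_lift_linear.
exact: tensor_lift_alt.
Qed.

Lemma wedge_lift_linear : linear wedge_lift.
Proof.
by apply: quot_lift_linear; [exact: tensor_lift_linear|exact: tensor_lift_alt].
Qed.

End Lift.
End Wedge.

HB.mixin Record Lmodule_isHomLeibniz (K : fieldType) L of GRing.Lmodule K L := {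
  br : L -> L -> L;
  al : L -> L;
  br_linl : forall y, linear (br^~ y);
  br_linr : forall x, linear (br x);
  al_lin : linear al;
  hom_leibniz : forall x y z,
    br (al x) (br y z) = br (br x y) (al z) - br (br x z) (al y);
  al_br : forall x y, al (br x y) = br (al x) (al y)
}.

#[short(type="homLeibnizType")]
HB.structure Definition HomLeibniz (K : fieldType) :=
  {L of Lmodule_isHomLeibniz K L & GRing.Lmodule K L}.

HB.mixin Record HomLeibniz_isHomLie (K : fieldType) L of HomLeibniz K L := {
  brxx : forall x : L, br x x = 0
}.

#[short(type="homLieType")]
HB.structure Definition HomLie (K : fieldType) :=
  {L of HomLeibniz_isHomLie K L & HomLeibniz K L}.

HB.instance Definition _ (K : fieldType) (L : homLeibnizType K) :=
  GRing.isLinear.Build K L L _ (@al K L) (@al_lin K L).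

Section Definitions.
Variable K : fieldType.

Definition hom_morphism (L M : homLeibnizType K) (f : L -> M) : Prop :=
  [/\ linear f, {morph f : x y / br x y} & {morph f : x / al x}].

Definition in_center (L : homLeibnizType K) (x : L) : Prop :=
  forall y, br x y = 0 /\ br y x = 0.

Variant al_bracket (L : homLeibnizType K) : L -> Prop :=
  AlBracket x y : al_bracket (br (al x) (al y)).

Definition alpha_perfect (L : homLeibnizType K) : Prop :=
  forall x : L, x \in lspan (@al_bracket L).

Definition al_surjective (L : homLeibnizType K) : Prop :=
  forall y : L, exists x, al x = y.

Definition central_extension (E L : homLeibnizType K) (p : E -> L) : Prop :=
  [/\ hom_morphism p, (forall y, exists x, p x = y)
    & forall x, p x = 0 -> in_center x].

(* Universality among central extensions by Hom-Leibniz algebras, also when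
   L happens to be a Hom-Lie algebra. *)
Definition universal_central_extension (E L : homLeibnizType K) (p : E -> L) :
    Prop :=
  central_extension p /\
  forall (E' : homLeibnizType K) (p' : E' -> L), central_extension p' ->
    exists h : E -> E', [/\ hom_morphism h, p' \o h =1 p
      & forall h' : E -> E', hom_morphism h' -> p' \o h' =1 p -> h' =1 h].

Definition alpha_central_extension (E L : homLeibnizType K) (p : E -> L) :
    Prop :=
  [/\ hom_morphism p, (forall y, exists x, p x = y)
    & forall x, p x = 0 -> in_center (al x)].

(* uceLeib_proj and uceLie_proj below satisfy the next two properties when al
   is injective, but not for every alpha-perfect L: if g is the direct sum of
   copies of sl_2(Q) indexed by nat and a : g -> g is the left shift, then the
   Hom-Lie algebra (g, a [x, y], a) is alpha-perfect and no homomorphism h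
   satisfies a^2 h = a. *)
Definition universal_alpha_central_leib (E L : homLeibnizType K) (p : E -> L) :
    Prop :=
  central_extension p /\
  forall (E' : homLeibnizType K) (p' : E' -> L), alpha_central_extension p' ->
    exists h : E -> E', [/\ hom_morphism h, p' \o h =1 p
      & forall h' : E -> E', hom_morphism h' -> p' \o h' =1 p -> h' =1 h].

Definition universal_alpha_central_lie (E L : homLieType K) (p : E -> L) :
    Prop :=
  central_extension p /\
  forall (E' : homLieType K) (p' : E' -> L), alpha_central_extension p' ->
    exists h : E -> E', [/\ hom_morphism h, p' \o h =1 p
      & forall h' : E -> E', hom_morphism h' -> p' \o h' =1 p -> h' =1 h].

Lemma alpha_perfect_surj (L : homLeibnizType K) :
  alpha_perfect L -> al_surjective L.
Proof.
move=> perf y; move: (perf y); move: y; apply: lspan_ind.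
- by exists 0; rewrite linear0.
- by move=> a u v [x <-] [z <-]; exists (a *: x + z); rewrite linearP.
- by move=> _ [x z]; exists (br x z); rewrite al_br.
Qed.

End Definitions.

Section LinearFacts.
Variables (K : fieldType) (V W : lmodType K) (f : V -> W).
Hypothesis f_lin : linear f.

Fact lin0 : f 0 = 0.
Proof. by have := f_lin (-1) 0 0; rewrite scaler0 addr0 scaleN1r addNr. Qed.

Fact linD x y : f (x + y) = f x + f y.
Proof. by have := f_lin 1 x y; rewrite !scale1r. Qed.

Fact linN x : f (- x) = - f x.
Proof. by have := f_lin (-1) x 0; rewrite lin0 !addr0 !scaleN1r. Qed.

End LinearFacts.

Section AlphaImage.
Variables (K : fieldType) (L : homLeibnizType K) (perf : alpha_perfect L).

(* The subspace alpha_L(L); it is all of L when L is alpha-perfect, which is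
   what makes [x, y] (x) alpha z meaningful in its tensor square. *)
Definition alimage : Type := limage (@al K L).
HB.instance Definition _ := SubChoice.on alimage.
HB.instance Definition _ := GRing.SubLmodule.on alimage.

Fact in_alimage x : in_limage (@al K L) x.
Proof. by apply/asboolP; exact: alpha_perfect_surj. Qed.

Definition inA (x : L) : alimage := exist _ x (in_alimage x).

Fact inA_lin : linear inA.
Proof. by move=> a x y; apply: val_inj; rewrite linearP. Qed.

Lemma val_inA x : val (inA x) = x. Proof. by []. Qed.
Lemma inA_val (a : alimage) : inA (val a) = a. Proof. exact: val_inj. Qed.

Fact val_br_linl (b : alimage) : linear (fun a : alimage => br (val a) (val b)).
Proof. by move=> k a a'; rewrite linearP /= br_linl. Qed.

Fact val_br_linr (a : alimage) : linear (fun b : alimage => br (val a) (val b)).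
Proof. by move=> k b b'; rewrite linearP /= br_linr. Qed.

Definition alA (a : alimage) : alimage := inA (al (val a)).

Fact alA_lin : linear alA.
Proof. by move=> k a b; apply: val_inj; rewrite /= !linearP. Qed.

End AlphaImage.

Section UceLeib.
Variables (K : fieldType) (L : homLeibnizType K) (perf : alpha_perfect L).
Local Notation A := (alimage L).
Local Notation inA := (inA perf).
Local Notation alA := (alA perf).

Variant leib_rel : tensor A A -> Prop := LeibRel x1 x2 x3 :
  leib_rel (- tens (inA (br x1 x2)) (inA (al x3))
            + tens (inA (br x1 x3)) (inA (al x2))
            + tens (inA (al x1)) (inA (br x2 x3))).

Definition uceLeib : Type := quotmod leib_rel.
HB.instance Definition _ := GRing.Lmodule.on uceLeib.

(* The class {a, b} of the tensor of a, b in alpha_L(L). *)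
Definition uceLeib_class (a b : A) : uceLeib := cls leib_rel (tens a b).
Local Notation c := uceLeib_class.

Fact uceLeib_classDl k a a' b : c (k *: a + a') b = k *: c a b + c a' b.
Proof. by rewrite /c tensDl linearP. Qed.

Fact uceLeib_classDr k a b b' : c a (k *: b + b') = k *: c a b + c a b'.
Proof. by rewrite /c tensDr linearP. Qed.

Lemma uceLeib_ind (P : uceLeib -> Prop) :
  P 0 -> (forall k x y, P x -> P y -> P (k *: x + y)) ->
  (forall a b, P (c a b)) -> forall x, P x.
Proof.
move=> P0 PD Pc; elim/cls_ind; apply: tensor_ind => [|k x y|//].
  by rewrite linear0.
by rewrite linearP; exact: PD.
Qed.

Lemma uceLeib_rel x1 x2 x3 :
  c (inA (al x1)) (inA (br x2 x3)) =
  c (inA (br x1 x2)) (inA (al x3)) - c (inA (br x1 x3)) (inA (al x2)).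
Proof.
have /cls_eq0 : - tens (inA (br x1 x2)) (inA (al x3))
    + tens (inA (br x1 x3)) (inA (al x2))
    + tens (inA (al x1)) (inA (br x2 x3)) \in lspan leib_rel.
  exact: mem_lspan.
rewrite addrC !raddfD raddfN => /eqP.
rewrite addr_eq0 => /eqP.
by rewrite opprD opprK.
Qed.

(* The projection U_alpha onto L. *)
Definition uceLeib_proj : uceLeib -> L :=
  quot_lift (tensor_lift (fun a b : A => br (val a) (val b))).

Fact uceLeib_proj_rel t :
  leib_rel t -> tensor_lift (fun a b : A => br (val a) (val b)) t = 0.
Proof.
set f := tensor_lift _; have fl : linear f.
  by apply: tensor_lift_linear; [exact: val_br_linl|exact: val_br_linr].
have fE a b : f (tens a b) = br (val a) (val b).
  by apply: tensor_liftE; [exact: val_br_linl|exact: val_br_linr].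
case=> x1 x2 x3; rewrite !(linD fl) (linN fl) !fE /= hom_leibniz.
by rewrite [- _ + _]addrC -opprB addNr.
Qed.

Lemma uceLeib_projE a b : uceLeib_proj (c a b) = br (val a) (val b).
Proof.
rewrite /uceLeib_proj quot_liftE; last exact: uceLeib_proj_rel.
  by apply: tensor_liftE; [exact: val_br_linl|exact: val_br_linr].
by apply: tensor_lift_linear; [exact: val_br_linl|exact: val_br_linr].
Qed.

Fact uceLeib_proj_lin : linear uceLeib_proj.
Proof.
apply: quot_lift_linear; last exact: uceLeib_proj_rel.
by apply: tensor_lift_linear; [exact: val_br_linl|exact: val_br_linr].
Qed.

Fact uceLeib_al_linl b : linear (fun a => c (alA a) (alA b)).
Proof. by move=> k a a'; rewrite alA_lin uceLeib_classDl. Qed.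

Fact uceLeib_al_linr a : linear (fun b => c (alA a) (alA b)).
Proof. by move=> k b b'; rewrite alA_lin uceLeib_classDr. Qed.

Definition uceLeib_al : uceLeib -> uceLeib :=
  quot_lift (tensor_lift (fun a b => c (alA a) (alA b))).

Fact uceLeib_al_rel t :
  leib_rel t -> tensor_lift (fun a b => c (alA a) (alA b)) t = 0.
Proof.
set f := tensor_lift _; have fl : linear f.
  by apply: tensor_lift_linear; [exact: uceLeib_al_linl|exact: uceLeib_al_linr].
have fE a b : f (tens a b) = c (alA a) (alA b).
  by apply: tensor_liftE; [exact: uceLeib_al_linl|exact: uceLeib_al_linr].
case=> x1 x2 x3; rewrite !(linD fl) (linN fl) !fE /alA /= !al_br.
by rewrite uceLeib_rel [- _ + _]addrC -opprB addNr.
Qed.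

Lemma uceLeib_alE a b : uceLeib_al (c a b) = c (alA a) (alA b).
Proof.
rewrite /uceLeib_al quot_liftE; last exact: uceLeib_al_rel.
  by apply: tensor_liftE; [exact: uceLeib_al_linl|exact: uceLeib_al_linr].
by apply: tensor_lift_linear; [exact: uceLeib_al_linl|exact: uceLeib_al_linr].
Qed.

Fact uceLeib_al_lin : linear uceLeib_al.
Proof.
apply: quot_lift_linear; last exact: uceLeib_al_rel.
by apply: tensor_lift_linear; [exact: uceLeib_al_linl|exact: uceLeib_al_linr].
Qed.

(* The bilinear extension of [{a, b}, {a', b'}] = {[a, b], [a', b']}. *)
Definition uceLeib_br (p q : uceLeib) : uceLeib :=
  c (inA (uceLeib_proj p)) (inA (uceLeib_proj q)).

Fact uceLeib_br_linl q : linear (uceLeib_br^~ q).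
Proof.
by move=> k p p'; rewrite /uceLeib_br uceLeib_proj_lin inA_lin uceLeib_classDl.
Qed.

Fact uceLeib_br_linr p : linear (uceLeib_br p).
Proof.
by move=> k q q'; rewrite /uceLeib_br uceLeib_proj_lin inA_lin uceLeib_classDr.
Qed.

Lemma uceLeib_proj_br p q :
  uceLeib_proj (uceLeib_br p q) = br (uceLeib_proj p) (uceLeib_proj q).
Proof. exact: uceLeib_projE. Qed.

Lemma uceLeib_proj_al p : uceLeib_proj (uceLeib_al p) = al (uceLeib_proj p).
Proof.
elim/uceLeib_ind: p => [|k p q pE qE|a b].
- by rewrite (lin0 uceLeib_al_lin) (lin0 uceLeib_proj_lin) linear0.
- by rewrite uceLeib_al_lin !uceLeib_proj_lin pE qE linearP.
- by rewrite uceLeib_alE !uceLeib_projE /= al_br.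
Qed.

Fact uceLeib_hom_leibniz x y z :
  uceLeib_br (uceLeib_al x) (uceLeib_br y z) =
  uceLeib_br (uceLeib_br x y) (uceLeib_al z)
  - uceLeib_br (uceLeib_br x z) (uceLeib_al y).
Proof.
by rewrite /uceLeib_br !uceLeib_proj_al !uceLeib_proj_br uceLeib_rel.
Qed.

Fact uceLeib_al_br x y :
  uceLeib_al (uceLeib_br x y) = uceLeib_br (uceLeib_al x) (uceLeib_al y).
Proof. by rewrite /uceLeib_br uceLeib_alE !uceLeib_proj_al. Qed.

HB.instance Definition _ := Lmodule_isHomLeibniz.Build K uceLeib
  uceLeib_br_linl uceLeib_br_linr uceLeib_al_lin
  uceLeib_hom_leibniz uceLeib_al_br.

Lemma uceLeib_brE a b a' b' :
  br (c a b) (c a' b') =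
  c (inA (br (val a) (val b))) (inA (br (val a') (val b'))).
Proof. by rewrite /br /= /uceLeib_br !uceLeib_projE. Qed.

Lemma uceLeib_al_surj : al_surjective uceLeib.
Proof.
elim/uceLeib_ind => [|k p q [p' <-] [q' <-]|a b].
- by exists 0; rewrite linear0.
- by exists (k *: p' + q'); rewrite linearP.
- have [x xa] := alpha_perfect_surj perf (val a).
  have [y yb] := alpha_perfect_surj perf (val b).
  exists (c (inA x) (inA y)); rewrite /al /= uceLeib_alE /alA /= xa yb.
  by rewrite !inA_val.
Qed.

End UceLeib.
Arguments uceLeib_proj {K L} perf _.
Arguments uceLeib_al_surj {K L} perf _.

Fact brC (K : fieldType) (L : homLieType K) (x y : L) : br x y = - br y x.
Proof.
apply/eqP; rewrite -addr_eq0; apply/eqP; have := brxx (1 *: x + y).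
by rewrite br_linl !br_linr !brxx !scale1r add0r addr0.
Qed.

Section UceLie.
Variables (K : fieldType) (L : homLieType K) (perf : alpha_perfect L).
Local Notation A := (alimage L).
Local Notation inA := (inA perf).
Local Notation alA := (alA perf).

Variant lie_rel : exterior2 A -> Prop := LieRel x1 x2 x3 :
  lie_rel (- wedge (inA (br x1 x2)) (inA (al x3))
           + wedge (inA (br x1 x3)) (inA (al x2))
           - wedge (inA (br x2 x3)) (inA (al x1))).

Definition uceLie : Type := quotmod lie_rel.
HB.instance Definition _ := GRing.Lmodule.on uceLie.

(* The class {a, b} of the wedge of a, b in alpha_L(L). *)
Definition uceLie_class (a b : A) : uceLie := cls lie_rel (wedge a b).
Local Notation c := uceLie_class.

Fact uceLie_classDl k a a' b : c (k *: a + a') b = k *: c a b + c a' b.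
Proof. by rewrite /c wedgeDl linearP. Qed.

Fact uceLie_classDr k a b b' : c a (k *: b + b') = k *: c a b + c a b'.
Proof. by rewrite /c wedgeDr linearP. Qed.

Fact uceLie_classxx a : c a a = 0.
Proof. by rewrite /c wedgexx linear0. Qed.

Fact uceLie_classC a b : c a b = - c b a.
Proof. by rewrite /c wedgeC linearN. Qed.

Lemma uceLie_ind (P : uceLie -> Prop) :
  P 0 -> (forall k x y, P x -> P y -> P (k *: x + y)) ->
  (forall a b, P (c a b)) -> forall x, P x.
Proof.
move=> P0 PD Pc; elim/cls_ind; apply: exterior2_ind => [|k x y|//].
  by rewrite linear0.
by rewrite linearP; exact: PD.
Qed.

Lemma uceLie_rel x1 x2 x3 :
  c (inA (al x1)) (inA (br x2 x3)) =
  c (inA (br x1 x2)) (inA (al x3)) - c (inA (br x1 x3)) (inA (al x2)).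
Proof.
have /cls_eq0 : - wedge (inA (br x1 x2)) (inA (al x3))
    + wedge (inA (br x1 x3)) (inA (al x2))
    - wedge (inA (br x2 x3)) (inA (al x1)) \in lspan lie_rel.
  exact: mem_lspan.
rewrite -(wedgeC (inA (al x1)) (inA (br x2 x3))) addrC !raddfD raddfN => /eqP.
rewrite addr_eq0 => /eqP.
by rewrite opprD opprK.
Qed.

Fact val_brxx (a : A) : br (val a) (val a) = 0. Proof. exact: brxx. Qed.

(* The projection u_alpha onto L. *)
Definition uceLie_proj : uceLie -> L :=
  quot_lift (wedge_lift (fun a b : A => br (val a) (val b))).

Fact uceLie_proj_rel t :
  lie_rel t -> wedge_lift (fun a b : A => br (val a) (val b)) t = 0.
Proof.
set f := wedge_lift _; have fl : linear f.
  by apply: wedge_lift_linear; [exact: val_br_linl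
    |exact: val_br_linr|exact: val_brxx].
have fE a b : f (wedge a b) = br (val a) (val b).
  by apply: wedge_liftE; [exact: val_br_linl
    |exact: val_br_linr|exact: val_brxx].
case=> x1 x2 x3; rewrite !(linD fl) !(linN fl) !fE /= -(brC (al x1)).
rewrite hom_leibniz.
by rewrite [- _ + _]addrC -opprB addNr.
Qed.

Lemma uceLie_projE a b : uceLie_proj (c a b) = br (val a) (val b).
Proof.
rewrite /uceLie_proj quot_liftE; last exact: uceLie_proj_rel.
  by apply: wedge_liftE; [exact: val_br_linl
    |exact: val_br_linr|exact: val_brxx].
by apply: wedge_lift_linear; [exact: val_br_linl
    |exact: val_br_linr|exact: val_brxx].
Qed.

Fact uceLie_proj_lin : linear uceLie_proj.
Proof.
apply: quot_lift_linear; last exact: uceLie_proj_rel.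
by apply: wedge_lift_linear; [exact: val_br_linl
    |exact: val_br_linr|exact: val_brxx].
Qed.

Fact uceLie_al_linl b : linear (fun a => c (alA a) (alA b)).
Proof. by move=> k a a'; rewrite alA_lin uceLie_classDl. Qed.

Fact uceLie_al_linr a : linear (fun b => c (alA a) (alA b)).
Proof. by move=> k b b'; rewrite alA_lin uceLie_classDr. Qed.

Fact uceLie_al_alt a : c (alA a) (alA a) = 0. Proof. exact: uceLie_classxx. Qed.

Definition uceLie_al : uceLie -> uceLie :=
  quot_lift (wedge_lift (fun a b => c (alA a) (alA b))).

Fact uceLie_al_rel t :
  lie_rel t -> wedge_lift (fun a b => c (alA a) (alA b)) t = 0.
Proof.
set f := wedge_lift _; have fl : linear f.
  by apply: wedge_lift_linear; [exact: uceLie_al_linl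
    |exact: uceLie_al_linr|exact: uceLie_al_alt].
have fE a b : f (wedge a b) = c (alA a) (alA b).
  by apply: wedge_liftE; [exact: uceLie_al_linl
    |exact: uceLie_al_linr|exact: uceLie_al_alt].
case=> x1 x2 x3; rewrite !(linD fl) !(linN fl) !fE /alA /= !al_br.
rewrite -(uceLie_classC (inA (al (al x1)))) uceLie_rel.
by rewrite [- _ + _]addrC -opprB addNr.
Qed.

Lemma uceLie_alE a b : uceLie_al (c a b) = c (alA a) (alA b).
Proof.
rewrite /uceLie_al quot_liftE; last exact: uceLie_al_rel.
  by apply: wedge_liftE; [exact: uceLie_al_linl
    |exact: uceLie_al_linr|exact: uceLie_al_alt].
by apply: wedge_lift_linear; [exact: uceLie_al_linl
    |exact: uceLie_al_linr|exact: uceLie_al_alt].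
Qed.

Fact uceLie_al_lin : linear uceLie_al.
Proof.
apply: quot_lift_linear; last exact: uceLie_al_rel.
by apply: wedge_lift_linear; [exact: uceLie_al_linl
    |exact: uceLie_al_linr|exact: uceLie_al_alt].
Qed.

(* The bilinear extension of [{a, b}, {a', b'}] = {[a, b], [a', b']}. *)
Definition uceLie_br (p q : uceLie) : uceLie :=
  c (inA (uceLie_proj p)) (inA (uceLie_proj q)).

Fact uceLie_br_linl q : linear (uceLie_br^~ q).
Proof.
by move=> k p p'; rewrite /uceLie_br uceLie_proj_lin inA_lin uceLie_classDl.
Qed.

Fact uceLie_br_linr p : linear (uceLie_br p).
Proof.
by move=> k q q'; rewrite /uceLie_br uceLie_proj_lin inA_lin uceLie_classDr.
Qed.

Lemma uceLie_proj_br p q :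
  uceLie_proj (uceLie_br p q) = br (uceLie_proj p) (uceLie_proj q).
Proof. exact: uceLie_projE. Qed.

Lemma uceLie_proj_al p : uceLie_proj (uceLie_al p) = al (uceLie_proj p).
Proof.
elim/uceLie_ind: p => [|k p q pE qE|a b].
- by rewrite (lin0 uceLie_al_lin) (lin0 uceLie_proj_lin) linear0.
- by rewrite uceLie_al_lin !uceLie_proj_lin pE qE linearP.
- by rewrite uceLie_alE !uceLie_projE /= al_br.
Qed.

Fact uceLie_hom_leibniz x y z :
  uceLie_br (uceLie_al x) (uceLie_br y z) =
  uceLie_br (uceLie_br x y) (uceLie_al z)
  - uceLie_br (uceLie_br x z) (uceLie_al y).
Proof. by rewrite /uceLie_br !uceLie_proj_al !uceLie_proj_br uceLie_rel. Qed.

Fact uceLie_al_br x y :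
  uceLie_al (uceLie_br x y) = uceLie_br (uceLie_al x) (uceLie_al y).
Proof. by rewrite /uceLie_br uceLie_alE !uceLie_proj_al. Qed.

HB.instance Definition _ := Lmodule_isHomLeibniz.Build K uceLie
  uceLie_br_linl uceLie_br_linr uceLie_al_lin
  uceLie_hom_leibniz uceLie_al_br.

Fact uceLie_brxx (x : uceLie) : br x x = 0.
Proof. exact: uceLie_classxx. Qed.

HB.instance Definition _ := HomLeibniz_isHomLie.Build K uceLie uceLie_brxx.

Lemma uceLie_brE a b a' b' :
  br (c a b) (c a' b') =
  c (inA (br (val a) (val b))) (inA (br (val a') (val b'))).
Proof. by rewrite /br /= /uceLie_br !uceLie_projE. Qed.

End UceLie.
Arguments uceLie_proj {K L} perf _.

Section Lieization.
Variables (K : fieldType) (Q : homLeibnizType K) (surj : al_surjective Q).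

Variant square : Q -> Prop := Square x : square (br x x).

(* Surjectivity of al makes the span of the squares an ideal; surj is a
   parameter so that the structures below can be attached to the quotient. *)
Definition lieization of al_surjective Q : Type := quotmod square.
Local Notation QL := (lieization surj).
HB.instance Definition _ := GRing.Lmodule.on QL.

Definition lie_class (x : Q) : QL := cls square x.

Fact square_brl z w : w \in lspan square -> br z w = 0.
Proof.
have [z' <-] := surj z; move: w; apply: lspan_ind.
- by rewrite (lin0 (br_linr _)).
- by move=> k u v uE vE; rewrite br_linr uE vE scaler0 addr0.
- by move=> _ [x]; rewrite hom_leibniz subrr.
Qed.

Fact square_brr z w : w \in lspan square -> br w z \in lspan square.
Proof.
move=> wS; have wz0 := square_brl z wS; have ww0 := square_brl w wS.
have -> : br w z = br (w + z) (w + z) - br z z.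
  have DL x y t : br (x + y) t = br x t + br y t by rewrite (linD (br_linl t)).
  have DR x y t : br t (x + y) = br t x + br t y by rewrite (linD (br_linr t)).
  by rewrite DL !DR wz0 ww0 !add0r addrK.
by rewrite rpredB // mem_lspan //; constructor.
Qed.

Fact square_al w : w \in lspan square -> al w \in lspan square.
Proof.
move: w; apply: lspan_ind => [|k u v uE vE|_ [x]].
- by rewrite linear0 rpred0.
- by rewrite linearP rpredD // rpredZ.
- by rewrite al_br mem_lspan //; constructor.
Qed.

Definition lie_br (p q : QL) : QL := lie_class (br (rep p) (rep q)).
Definition lie_al (p : QL) : QL := lie_class (al (rep p)).

Lemma lie_brE x y : lie_br (lie_class x) (lie_class y) = lie_class (br x y).
Proof.
have rx : rep (lie_class x) - x \in lspan square.
  by apply/cls_eqP; exact: repK.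
have ry : rep (lie_class y) - y \in lspan square.
  by apply/cls_eqP; exact: repK.
apply/cls_eqP; move: rx ry; set x' := rep _; set y' := rep _ => rx ry.
have -> : br x' y' - br x y = br (x' - x) y' + br x (y' - y).
  rewrite (linD (br_linl _)) (linN (br_linl _)).
  by rewrite (linD (br_linr _)) (linN (br_linr _)) addrA subrK.
by rewrite (square_brl x ry) addr0 square_brr.
Qed.

Lemma lie_alE x : lie_al (lie_class x) = lie_class (al x).
Proof.
apply/cls_eqP; rewrite -linearB square_al //.
by apply/cls_eqP; exact: repK.
Qed.

Lemma lie_class_ind (P : QL -> Prop) :
  (forall x, P (lie_class x)) -> forall p, P p.
Proof. exact: cls_ind. Qed.

Lemma lie_class_lin : linear lie_class.
Proof. exact: cls_linear. Qed.

Fact lie_br_linl q : linear (lie_br^~ q).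
Proof.
move=> k; elim/lie_class_ind: q => z; elim/lie_class_ind => x.
elim/lie_class_ind => y.
by rewrite -lie_class_lin !lie_brE br_linl lie_class_lin.
Qed.

Fact lie_br_linr p : linear (lie_br p).
Proof.
move=> k; elim/lie_class_ind: p => z; elim/lie_class_ind => x.
elim/lie_class_ind => y.
by rewrite -lie_class_lin !lie_brE br_linr lie_class_lin.
Qed.

Fact lie_al_lin : linear lie_al.
Proof.
move=> k; elim/lie_class_ind => x; elim/lie_class_ind => y.
by rewrite -lie_class_lin !lie_alE linearP lie_class_lin.
Qed.

Fact lie_hom_leibniz x y z :
  lie_br (lie_al x) (lie_br y z) =
  lie_br (lie_br x y) (lie_al z) - lie_br (lie_br x z) (lie_al y).
Proof.
elim/lie_class_ind: x => x; elim/lie_class_ind: y => y.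
elim/lie_class_ind: z => z.
rewrite !lie_alE !lie_brE hom_leibniz.
by rewrite (linD lie_class_lin) (linN lie_class_lin).
Qed.

Fact lie_al_br x y : lie_al (lie_br x y) = lie_br (lie_al x) (lie_al y).
Proof.
elim/lie_class_ind: x => x; elim/lie_class_ind: y => y.
by rewrite lie_brE !lie_alE lie_brE al_br.
Qed.

HB.instance Definition _ := Lmodule_isHomLeibniz.Build K QL
  lie_br_linl lie_br_linr lie_al_lin lie_hom_leibniz lie_al_br.

Fact lie_brxx (x : QL) : br x x = 0.
Proof.
elim/lie_class_ind: x => x; rewrite /br /= lie_brE.
by apply/cls_eq0; apply: mem_lspan; constructor.
Qed.

HB.instance Definition _ := HomLeibniz_isHomLie.Build K QL lie_brxx.

End Lieization.

(* Main.v *)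
Require Import Defs.
From mathcomp Require Import all_boot all_algebra.

(** The kernel of the canonical surjection Phi : uceLeib -> uceLie is central
because the bracket of uceLeib only sees the images in L. If p' : E' -> uceLie
is a central extension, its composite with uceLie -> L is alpha-central
although E' need not be perfect, since E' = [E', E'] + ker p'. The universal
property of uceLeib therefore yields a unique h over L, and h lies over uceLie
because two morphisms from uceLeib to uceLie over L coincide.
Finally {a, a} is a square in uceLeib, as a lifts to uceLeib, so Phi induces
an isomorphism from the Lie quotient of uceLeib. *)

Set Implicit Arguments.
Unset Strict Implicit.
Unset Printing Implicit Defensive.

Import GRing.Theory.
Local Open Scope ring_scope.

(** * Composites of central extensions *)

Section CentralExtensions.
Variable K : fieldType.

Lemma hom_morphism_comp (E M L : homLeibnizType K) (f : E -> M) (g : M -> L) :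
  hom_morphism f -> hom_morphism g -> hom_morphism (g \o f).
Proof.
case=> fl fb fa [gl gb ga]; split=> [k x y|x y|x] /=; first by rewrite fl gl.
  by rewrite fb gb.
by rewrite fa ga.
Qed.

Lemma central_extension_alpha (E L : homLeibnizType K) (p : E -> L) :
  central_extension p -> alpha_central_extension p.
Proof.
case=> pm ps pc; split=> // x px0; apply: pc.
by case: pm => pl _ pa; rewrite pa px0 linear0.
Qed.

Lemma comp_alpha_central_extension (E M L : homLeibnizType K)
    (p : E -> M) (u : M -> L) :
  alpha_perfect M -> central_extension p -> central_extension u ->
  alpha_central_extension (u \o p).
Proof.
move=> perfM [pm ps pc] [um us uc]; split; first exact: hom_morphism_comp.
  by move=> y; have [x <-] := us y; have [z <-] := ps x; exists z.
move=> x /= /uc px_central; have [pl pb pa] := pm.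
(* [p x] is central in [M], so brackets with [x] fall into the kernel of [p], which is central in
   [E]. *)
have xy_central y : in_center (br x y) /\ in_center (br y x).
  by have [xy yx] := px_central (p y); split; apply: pc; rewrite pb ?xy ?yx.
(* [al x] commutes with brackets of E by the Leibniz identity, and an element
   of E is determined by its image up to central elements. *)
suff H m y : p y = m -> br (al x) y = 0 /\ br y (al x) = 0 by move=> y; exact: H.
(* The claim ranges over all lifts [y]: to treat a combination, lift one summand freely and let the
   difference be the lift of the other. *)
move: (perfM m) y; move: m; apply: lspan_ind.
- by move=> y /pc /(_ (al x))[].
- move=> a m n IHm IHn y py.
  have [m' pm'] := ps m; have [xm mx] := IHm _ pm'.
  have py' : p (y - a *: m') = n.
    have -> : y - a *: m' = (- a) *: m' + y by rewrite scaleNr addrC.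
    by rewrite pl pm' py scaleNr addKr.
  have [xn nx] := IHn _ py'.
  have -> : y = a *: m' + (y - a *: m') by rewrite addrCA subrr addr0.
  by rewrite br_linr br_linl xm mx xn nx scaler0 addr0.
- move=> _ [m n] y py.
  have [m' pm'] := ps (al m); have [n' pn'] := ps (al n).
  have z_central : in_center (y - br m' n').
    by apply: pc; rewrite (linD pl) (linN pl) pb pm' pn' py subrr.
  have -> : y = br m' n' + (y - br m' n') by rewrite addrCA subrr addr0.
  have [zx xz] := z_central (al x).
  rewrite (linD (br_linr _)) (linD (br_linl _)) xz zx !addr0 hom_leibniz.
  have [/(_ (al n'))[-> _] _] := xy_central m'.
  have [/(_ (al m'))[-> _] /(_ (al m'))[_ mnx]] := xy_central n'.
  split; first by rewrite subrr.
  (* For the other order, the Leibniz identity at [m'], [n'], [x] is solved for [[m', n'], al x]. *)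
  have [_ /(_ (al n'))[mxn _]] := xy_central m'.
  by have := hom_leibniz m' n' x; rewrite mnx mxn subr0 => <-.
Qed.

End CentralExtensions.

(** * The two universal extensions over [L] *)

Section Uce.
Variables (K : fieldType) (L : homLieType K) (perf : alpha_perfect L).
Local Notation QL := (lieization (uceLeib_al_surj perf)).

Let class_linl b : linear (fun a => uceLie_class perf a b).
Proof. by move=> k a a'; exact: uceLie_classDl. Qed.

Let class_linr a : linear (uceLie_class perf a).
Proof. by move=> k b b'; exact: uceLie_classDr. Qed.

Let leib_class_linl b : linear (fun a => uceLeib_class perf a b).
Proof. by move=> k a a'; exact: uceLeib_classDl. Qed.

Let leib_class_linr a : linear (uceLeib_class perf a).
Proof. by move=> k b b'; exact: uceLeib_classDr. Qed.

(** True by conversion. It exhibits a class {a, b} as a bracket once [a] and [b] are lifted through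
    the projection. *)
Lemma uceLie_class_brE (p q : uceLie perf) :
  uceLie_class perf (inA perf (uceLie_proj perf p))
                    (inA perf (uceLie_proj perf q)) = br p q.
Proof. by []. Qed.

Lemma uceLeib_class_brE (p q : uceLeib perf) :
  uceLeib_class perf (inA perf (uceLeib_proj perf p))
                     (inA perf (uceLeib_proj perf q)) = br p q.
Proof. by []. Qed.

Lemma uceLie_proj_surj x : exists p, uceLie_proj perf p = x.
Proof.
move: (perf x); move: x; apply: lspan_ind.
- by exists 0; rewrite (lin0 (@uceLie_proj_lin _ _ perf)).
- by move=> a u v [p <-] [q <-]; exists (a *: p + q); rewrite uceLie_proj_lin.
- move=> _ [x y]; exists (uceLie_class perf (inA perf (al x)) (inA perf (al y))).
  by rewrite uceLie_projE.
Qed.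

Lemma uceLeib_proj_surj x : exists p, uceLeib_proj perf p = x.
Proof.
move: (perf x); move: x; apply: lspan_ind.
- by exists 0; rewrite (lin0 (@uceLeib_proj_lin _ _ perf)).
- by move=> a u v [p <-] [q <-]; exists (a *: p + q); rewrite uceLeib_proj_lin.
- move=> _ [x y]; exists (uceLeib_class perf (inA perf (al x)) (inA perf (al y))).
  by rewrite uceLeib_projE.
Qed.

Lemma uceLie_al_surj : al_surjective (uceLie perf).
Proof.
elim/uceLie_ind => [|k p q [p' <-] [q' <-]|a b].
- by exists 0; rewrite linear0.
- by exists (k *: p' + q'); rewrite linearP.
- have [x xa] := alpha_perfect_surj perf (val a).
  have [y yb] := alpha_perfect_surj perf (val b).
  exists (uceLie_class perf (inA perf x) (inA perf y)).
  by rewrite /al /= uceLie_alE /alA /= xa yb !inA_val.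
Qed.

(** The classes {a, b} span, each is a bracket of lifts of [a] and [b], and these lifts are values
    of the surjective [al]. *)
Lemma uceLie_perfect : alpha_perfect (uceLie perf).
Proof.
elim/uceLie_ind => [|k p q pP qP|a b]; first exact: rpred0.
  by rewrite rpredD // rpredZ.
have [p pa] := uceLie_proj_surj (val a).
have [q qb] := uceLie_proj_surj (val b).
rewrite -(inA_val perf a) -(inA_val perf b) -pa -qb uceLie_class_brE.
have [p' <-] := uceLie_al_surj p; have [q' <-] := uceLie_al_surj q.
exact: mem_lspan.
Qed.

Lemma uceLie_proj_central : central_extension (uceLie_proj perf).
Proof.
split; last 2 first.
- exact: uceLie_proj_surj.
- move=> p p0 q; rewrite -!uceLie_class_brE p0 (lin0 (@inA_lin _ _ perf)).
  by rewrite (lin0 (class_linl _)) (lin0 (class_linr _)).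
by split; [exact: uceLie_proj_lin|exact: uceLie_proj_br|exact: uceLie_proj_al].
Qed.

(** * The canonical surjection and its universality *)

Definition uceLeib_to_uceLie : uceLeib perf -> uceLie perf :=
  quot_lift (tensor_lift (uceLie_class perf)).
Local Notation Phi := uceLeib_to_uceLie.

(** Up to antisymmetry of the wedge in the last term, the Leibniz relation is the Lie relation. *)
Lemma uceLie_class_leib_rel t :
  leib_rel perf t -> tensor_lift (uceLie_class perf) t = 0.
Proof.
set f := tensor_lift _; have fl : linear f by exact: tensor_lift_linear.
have fE a b : f (tens a b) = uceLie_class perf a b by exact: tensor_liftE.
case=> x1 x2 x3; rewrite !(linD fl) (linN fl) !fE uceLie_rel.
by rewrite [- _ + _]addrC -opprB addNr.
Qed.

Lemma uceLeib_to_uceLieE a b : Phi (uceLeib_class perf a b) = uceLie_class perf a b.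
Proof.
rewrite /Phi quot_liftE; last exact: uceLie_class_leib_rel.
  exact: tensor_liftE.
exact: tensor_lift_linear.
Qed.

Lemma uceLeib_to_uceLie_lin : linear Phi.
Proof.
apply: quot_lift_linear; last exact: uceLie_class_leib_rel.
exact: tensor_lift_linear.
Qed.

(** Both brackets factor through the projections to [L], so this compatibility yields that [Phi]
    preserves brackets and has central kernel. *)
Lemma uceLie_proj_uceLeib p : uceLie_proj perf (Phi p) = uceLeib_proj perf p.
Proof.
elim/uceLeib_ind: p => [|k p q pE qE|a b].
- by rewrite (lin0 uceLeib_to_uceLie_lin) (lin0 (@uceLie_proj_lin _ _ perf))
    (lin0 (@uceLeib_proj_lin _ _ perf)).
- by rewrite uceLeib_to_uceLie_lin uceLie_proj_lin uceLeib_proj_lin pE qE.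
- by rewrite uceLeib_to_uceLieE uceLie_projE uceLeib_projE.
Qed.

Lemma uceLeib_to_uceLie_hom : hom_morphism Phi.
Proof.
split; first exact: uceLeib_to_uceLie_lin.
  move=> p q; rewrite -uceLie_class_brE !uceLie_proj_uceLeib.
  by rewrite -uceLeib_class_brE uceLeib_to_uceLieE.
elim/uceLeib_ind => [|k p q pE qE|a b].
- by rewrite linear0 (lin0 uceLeib_to_uceLie_lin) linear0.
- by rewrite linearP !uceLeib_to_uceLie_lin linearP pE qE.
- by rewrite /al /= uceLeib_alE !uceLeib_to_uceLieE uceLie_alE.
Qed.

Lemma uceLeib_to_uceLie_surj y : exists x, Phi x = y.
Proof.
elim/uceLie_ind: y => [|k p q [p' <-] [q' <-]|a b].
- by exists 0; rewrite (lin0 uceLeib_to_uceLie_lin).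
- by exists (k *: p' + q'); rewrite uceLeib_to_uceLie_lin.
- by exists (uceLeib_class perf a b); rewrite uceLeib_to_uceLieE.
Qed.

Lemma uceLeib_to_uceLie_central : central_extension Phi.
Proof.
split; [exact: uceLeib_to_uceLie_hom|exact: uceLeib_to_uceLie_surj|].
move=> p p0 q; rewrite -!uceLeib_class_brE -!uceLie_proj_uceLeib p0.
rewrite (lin0 (@uceLie_proj_lin _ _ perf)) (lin0 (@inA_lin _ _ perf)).
by rewrite (lin0 (leib_class_linl _)) (lin0 (leib_class_linr _)).
Qed.

Lemma uceLeib_to_uceLie_universal :
  universal_alpha_central_leib (uceLeib_proj perf) ->
  universal_central_extension Phi.
Proof.
case=> _ univ; split; first exact: uceLeib_to_uceLie_central.
move=> E p pce; have [pm _ _] := pce.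
have [h [hm hE h_uniq]] := univ _ _
  (comp_alpha_central_extension uceLie_perfect pce uceLie_proj_central).
have [g [_ _ g_uniq]] :=
  univ _ _ (central_extension_alpha uceLie_proj_central).
exists h; split=> // [x|h' h'm h'E].
- rewrite (g_uniq _ (hom_morphism_comp hm pm)); last exact: hE.
  by rewrite (g_uniq _ uceLeib_to_uceLie_hom) //; exact: uceLie_proj_uceLeib.
(* A competitor over [uceLie] is in particular one over [L], where [h] is unique. *)
- by apply: h_uniq => // x; rewrite -uceLie_proj_uceLeib -h'E.
Qed.

(** * The Lie quotient of the Leibniz extension *)

Definition lie_uceLeib_class (a b : alimage L) : QL :=
  lie_class _ (uceLeib_class perf a b).

Definition uceLie_to_lie_uceLeib : uceLie perf -> QL :=
  quot_lift (wedge_lift lie_uceLeib_class).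
Local Notation psi := uceLie_to_lie_uceLeib.

Let lie_uceLeib_class_linl b : linear (lie_uceLeib_class^~ b).
Proof.
by move=> k a a'; rewrite /lie_uceLeib_class uceLeib_classDl lie_class_lin.
Qed.

Let lie_uceLeib_class_linr a : linear (lie_uceLeib_class a).
Proof.
by move=> k b b'; rewrite /lie_uceLeib_class uceLeib_classDr lie_class_lin.
Qed.

(** The alternating condition that lets [psi] descend to the exterior square. *)
Let lie_uceLeib_classxx a : lie_uceLeib_class a a = 0.
Proof.
have [p pa] := uceLeib_proj_surj (val a).
apply/cls_eq0; rewrite -(inA_val perf a) -pa uceLeib_class_brE.
by apply: mem_lspan; constructor.
Qed.

Let psi_free_lin : linear (wedge_lift lie_uceLeib_class).
Proof. exact: wedge_lift_linear. Qed.

Let psi_freeE a b :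
  wedge_lift lie_uceLeib_class (wedge a b) = lie_uceLeib_class a b.
Proof. exact: wedge_liftE. Qed.

Lemma lie_uceLeib_class_lie_rel t :
  lie_rel perf t -> wedge_lift lie_uceLeib_class t = 0.
Proof.
(* Swapping the last wedge brings the Lie relation into Leibniz form. *)
case=> x1 x2 x3; rewrite -(wedgeC (inA perf (al x1))).
rewrite !(linD psi_free_lin) (linN psi_free_lin) !psi_freeE.
rewrite /lie_uceLeib_class uceLeib_rel.
rewrite (linD (@lie_class_lin _ _ _)) (linN (@lie_class_lin _ _ _)).
by rewrite [- _ + _]addrC -opprB addNr.
Qed.

Lemma uceLie_to_lie_uceLeib_lin : linear psi.
Proof. by apply: quot_lift_linear; last exact: lie_uceLeib_class_lie_rel. Qed.

(** Since [Phi] is onto, this determines [psi]; its remaining properties follow by lifting arguments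
    along [Phi]. *)
Lemma uceLie_to_lie_uceLeibE p : psi (Phi p) = lie_class _ p.
Proof.
elim/uceLeib_ind: p => [|k p q pE qE|a b].
- by rewrite (lin0 uceLeib_to_uceLie_lin) (lin0 uceLie_to_lie_uceLeib_lin)
    (lin0 (@lie_class_lin _ _ _)).
- rewrite uceLeib_to_uceLie_lin uceLie_to_lie_uceLeib_lin pE qE.
  by rewrite lie_class_lin.
- rewrite uceLeib_to_uceLieE /psi quot_liftE //.
  exact: lie_uceLeib_class_lie_rel.
Qed.

Lemma uceLie_to_lie_uceLeib_hom : hom_morphism psi.
Proof.
have [_ Phi_br Phi_al] := uceLeib_to_uceLie_hom.
split; first exact: uceLie_to_lie_uceLeib_lin.
- move=> x y; have [p <-] := uceLeib_to_uceLie_surj x.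
  have [q <-] := uceLeib_to_uceLie_surj y.
  by rewrite -Phi_br !uceLie_to_lie_uceLeibE /br /= lie_brE.
- move=> x; have [p <-] := uceLeib_to_uceLie_surj x.
  by rewrite -Phi_al !uceLie_to_lie_uceLeibE /al /= lie_alE.
Qed.

Lemma uceLie_to_lie_uceLeib_bij : bijective psi.
Proof.
have [_ Phi_br _] := uceLeib_to_uceLie_hom.
(* The inverse of [psi]: [Phi] kills squares because its target is a Hom-Lie algebra, hence factors
   through the quotient. *)
pose PhiL : QL -> uceLie perf := quot_lift Phi.
have PhiE p : PhiL (lie_class _ p) = Phi p.
  apply: quot_liftE; first exact: uceLeib_to_uceLie_lin.
  by move=> _ [x]; rewrite Phi_br brxx.
exists PhiL.
- move=> x; have [p <-] := uceLeib_to_uceLie_surj x.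
  by rewrite uceLie_to_lie_uceLeibE PhiE.
- by elim/lie_class_ind => p; rewrite PhiE uceLie_to_lie_uceLeibE.
Qed.

End Uce.

Theorem proposition5p6 (K : fieldType) (L : homLieType K)
  (perf : alpha_perfect L)
  (uLie : universal_alpha_central_lie (uceLie_proj perf))
  (uLeib : universal_alpha_central_leib (uceLeib_proj perf)) :
  [/\ alpha_perfect (uceLie perf),
      exists Phi : uceLeib perf -> uceLie perf,
        universal_central_extension Phi
    & exists f : uceLie perf -> lieization (uceLeib_al_surj perf),
        hom_morphism f /\ bijective f].
Proof.
split; first exact: uceLie_perfect.
  exists (@uceLeib_to_uceLie _ _ perf); exact: uceLeib_to_uceLie_universal.
exists (@uceLie_to_lie_uceLeib _ _ perf); split.
  exact: uceLie_to_lie_uceLeib_hom.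
exact: uceLie_to_lie_uceLeib_bij.
Qed.
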